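(* Let $k\ge 1$ be an integer, $n=k(k+1)/2$ and let $\rho_k=(k,k-1,\ldots,1)$ be the staircase partition of $n$. For every partition $\lambda$ of $n$ with $\lambda\ne\rho_k$, $$\langle S^2([\lambda]),[\rho_k]\rangle=\langle A^2([\lambda]),[\rho_k]\rangle,$$ and, in particular, the Kronecker coefficient $g(\lambda,\lambda,\rho_k)$ is even.
   Context: For a partition $\lambda$ of $n$, $[\lambda]$ denotes the irreducible complex character of the symmetric group $S_n$ labelled by $\lambda$; $\langle\cdot,\cdot\rangle$ is the usual scalar product of class functions. For a character $\chi$ of a finite group, $S^2(\chi)(g)=\tfrac12(\chi(g)^2+\chi(g^2))$ and $A^2(\chi)(g)=\tfrac12(\chi(g)^2-\chi(g^2))$. The Kronecker coefficients $g(\lambda,\mu,\nu)$ are defined by $[\lambda][\mu]=\sum_\nu g(\lambda,\mu,\nu)[\nu]$ (pointwise product of characters). *)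

(* Defs.v *)
From HB Require Import structures.
From mathcomp Require Import all_boot all_order all_algebra all_fingroup
  all_solvable all_field all_character.

Set Implicit Arguments.
Unset Strict Implicit.
Unset Printing Implicit Defensive.

Import Order.TTheory GRing.Theory Num.Theory.
Local Open Scope ring_scope.

Definition is_intpart n (t : n.-tuple 'I_n.+1) : bool :=
  sorted geq [seq val i | i <- t] && (sumn [seq val i | i <- t] == n).

(* Partitions of n, padded with zeros to length exactly n. *)
Record intpart (n : nat) : predArgType :=
  IntPart { intpart_val : n.-tuple 'I_n.+1; _ : is_intpart intpart_val }.

HB.instance Definition _ n := [isSub for @intpart_val n].
HB.instance Definition _ n := [Finite of intpart n by <:].

Definition parts n (lam : intpart n) : seq nat :=
  [seq val i | i <- intpart_val lam].

Fact staircase_subproof k (n := (k * k.+1)./2) :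
  is_intpart [tuple inord (k - i) : 'I_n.+1 | i < n].
Proof.
rewrite /is_intpart; set t := [tuple _ | i < n].
have le_kn : (k <= n)%N.
  rewrite /n {t}; case: k @n => // k _.
  by rewrite -[leqLHS]doubleK half_leq // -muln2 leq_mul.
have ->: [seq val i | i <- t] = [seq (k - i)%N | i <- iota 0 n].
  rewrite /= -map_comp -val_enum_ord -map_comp; apply: eq_map => i /=.
  by rewrite inordK // ltnS (leq_trans (leq_subr _ _)).
apply/andP; split.
  apply: (@homo_sorted _ _ (fun i => k - i)%N leq geq) => [i j|].
    exact: leq_sub2l.
  exact: iota_sorted.
rewrite sumnE big_map.
have -> : iota 0 n = index_iota 0 n by rewrite /index_iota subn0.
rewrite (big_cat_nat _ le_kn) //= [X in (_ + X)%N]big_nat_cond.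
rewrite [X in (_ + X)%N]big1 => [|i /andP[/andP[le_ki _] _]]; last first.
  by apply/eqP; rewrite subn_eq0.
rewrite addn0 big_mkord /n.
have -> : (\sum_(i < k) (k - i) = \sum_(i < k.+1) i)%N.
  rewrite big_ord_recl add0n (reindex_inj rev_ord_inj) /=.
  by apply: eq_bigr => i _; rewrite subKn.
by rewrite -(big_mkord xpredT id) bin2_sum bin2 mulnC.
Qed.

(* (k, k-1, ..., 1, 0, ..., 0); the truncated k - i is 0 as soon as i >= k. *)
Definition staircase (k : nat) : intpart (k * k.+1)./2 :=
  IntPart (staircase_subproof k).

(* The Young tableau of shape lam used below lists 0, ..., n - 1 row after row;
   the entry i sits in row [row_of lam i] and column [col_of lam i]. *)
Definition row_of n (lam : intpart n) (i : 'I_n) := reshape_index (parts lam) i.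
Definition col_of n (lam : intpart n) (i : 'I_n) := reshape_offset (parts lam) i.

Definition row_stab n (lam : intpart n) : {set 'S_n} :=
  [set s : 'S_n | [forall i, row_of lam (s i) == row_of lam i]].
Definition col_stab n (lam : intpart n) : {set 'S_n} :=
  [set s : 'S_n | [forall i, col_of lam (s i) == col_of lam i]].

(* Young symmetrizer a_lam b_lam, as a vector of the regular representation.
   The product of permutations here is (q * p) i = p (q i), so q * p is the
   composite "p after q". *)
Definition young_sym n (lam : intpart n) : 'rV[algC]_#|[set: 'S_n]%G| :=
  \sum_(p in row_stab lam) \sum_(q in col_stab lam)
     (-1) ^+ odd_perm q *: delta_mx 0 (gring_index [set: 'S_n]%G (q * p)%g).

(* [lam], the character afforded by the Specht module, realised as the ideal of
   the group algebra generated by the Young symmetrizer. Right multiplication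
   for the above product is left multiplication for composition, so that this
   is the usual left ideal C[S_n] a_lam b_lam. *)
Definition sym_char n (lam : intpart n) : 'CF([set: 'S_n]) :=
  cfRepr (submod_repr
    (cyclic_mx_module (regular_repr algC [set: 'S_n]%G) (young_sym lam))).

Section Squares.

Variables (gT : finGroupType) (G : {group gT}).

(* Elements of 'CF(G) vanish outside G. *)
Fact square_subproof (e : algC) (phi : 'CF(G)) :
  is_class_fun <<G>>%g
    [ffun x => if x \in G then (phi x ^+ 2 + e * phi (x ^+ 2)%g) / 2 else 0].
Proof.
rewrite genGid; apply: intro_class_fun => [x y Gx Gy | x /negbTE-> //].
by rewrite groupJr // -conjXg !cfunJ.
Qed.

Definition sym_square (phi : 'CF(G)) : 'CF(G) :=
  Cfun 0 (square_subproof 1 phi).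
Definition alt_square (phi : 'CF(G)) : 'CF(G) :=
  Cfun 0 (square_subproof (-1) phi).

Lemma sym_squareE phi x :
  x \in G -> sym_square phi x = (phi x ^+ 2 + phi (x ^+ 2)%g) / 2.
Proof. by move=> Gx; rewrite cfunE Gx mul1r. Qed.

Lemma alt_squareE phi x :
  x \in G -> alt_square phi x = (phi x ^+ 2 - phi (x ^+ 2)%g) / 2.
Proof. by move=> Gx; rewrite cfunE Gx mulN1r. Qed.

End Squares.

(* The coefficient of [nu] in the expansion of [lam][mu] over the basis
   ([nu])_nu of the class functions. *)
Definition kronecker n (lam mu nu : intpart n) : algC :=
  coord [tuple sym_char (enum_val i) | i < #|intpart n|] (enum_rank nu)
    (sym_char lam * sym_char mu).

(* Main.v *)
Require Import Defs.
From mathcomp Require Import all_boot all_order all_algebra all_fingroup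
  all_solvable all_field all_character.
From mathcomp Require Import zify ring.

Set Implicit Arguments.
Unset Strict Implicit.
Unset Printing Implicit Defensive.

Import Order.TTheory GRing.Theory Num.Theory.
Local Open Scope ring_scope.

(** Write rho for the staircase character and lam for another partition of n.
    The difference of the two scalar products is
      1/n! * \sum_g [lam](g^2) * conj ([rho] g),
    and everything rests on two properties of [rho]: it vanishes on elements of
    even order ([staircase_even_order]), and it takes the same value at g and
    at g^2 when g has odd order ([staircase_sqr]). Squaring permutes the
    elements of odd order ([sum_sqr_odd_order]), so the sum above is just
    the scalar product of [lam] and [rho] ([cfdot_adams2]), which is 0. The Kronecker coefficient is
    the sum of the two equal scalar products, and the second one is a natural
    number because the alternating square of a character is a character
    ([alt_square_char]); hence it is twice a natural number.

    The vanishing of [rho] would follow from the Murnaghan-Nakayama rule, since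
    all hook lengths of a staircase are odd. Here it is read off from a
    determinantal expression. The class function [frob_cf] is Frobenius's
    alternating sum \sum_s sgn(s) M_s over s in 'S_k, where M_s is the
    permutation character on the k-colorings of {0..n-1} having 2j+1 - s(j)
    points of color j. These exponents come from rho + delta, whose parts
    1, 3, ..., 2k-1 are all the small odd numbers: removing an even cycle from
    one of them either makes it negative or makes it collide with another one,
    and the alternating sum cancels ([frob_even_cycle]). So [frob_cf] is
    supported on elements of odd order, and in particular it is equal to its
    own product with the sign character.

    If [mu] occurs in [frob_cf], then it occurs in some M_s, and, by the sign
    invariance, in some sgn * M_s' as well. The first fact produces a coloring
    that is injective on the columns of mu, the second one a coloring that is
    injective on its rows ([frob_constituent]). The number of points of each
    color is prescribed, and this bounds the sum of row + column over the cells
    of mu by its value at the staircase, which is the only partition attaining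
    the minimum ([staircase_of_energy]). Hence mu is the staircase and, as
    [frob_cf] is not zero, [rho] is a multiple of it ([staircase_char_frob]).

    This uses the classical theory of the characters [lam], proved here from
    the Young symmetrizer c: functions transforming like c under the column
    and row stabilizers are multiples of c ([biinvariantE]); thus c * c = h c,
    and as left multiplication by c is a multiple of a projection, [lam] is
    given by a trace ([sym_charE]). Orthonormality ([cfdot_sym_charE]) is then
    a computation, and completeness ([irr_is_sym_char]) holds because there are
    at most as many conjugacy classes as partitions. *)

(** * Dominance for column-injective fillings *)

Lemma sum_ltn_minn m b : (\sum_(t < b) (t < m) = minn b m)%N.
Proof.
elim: b => [|b IHb]; first by rewrite big_ord0 min0n.
by rewrite big_ord_recr /= IHb; lia.
Qed.

(** A Young diagram is given by the row [r x] and the column [c x] of each of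
    its cells, and enters through the fact that its columns have no gaps;
    exchanging [r] and [c] gives the same results for rows. A filling [u] that
    is injective on each column has, as a multiset, values at least as large as
    the row indices. *)
Section Diagrams.
Local Open Scope nat_scope.

Variables (T : finType) (r c u : T -> nat).

Hypothesis r_down : forall x i, i <= r x -> exists2 y, r y = i & c y = c x.
Hypothesis uc_inj : injective (fun x => (u x, c x)).

(** Either the column has a cell in row [t], and then it has a cell in each row
    below [t], which bounds the number of distinct values of [u] below [t]; or
    all its cells lie in rows below [t]. *)
Lemma card_lt_column t j :
  #|[set x | u x < t & c x == j]| <= #|[set x | r x < t & c x == j]|.
Proof.
case: (boolP [exists z, (t <= r z) && (c z == j)]) => [|/existsPn all_lt].
  case/existsP=> z /andP[le_t_rz /eqP cz].
  have u_inj : {in [set x | u x < t & c x == j] &,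
                  injective (fun x => inord (u x) : 'I_t.+1)}.
    move=> x y; rewrite !inE => /andP[ltx /eqP cx] /andP[lty /eqP cy].
    move/(congr1 val); rewrite /= !inordK ?ltnS 1?ltnW // => eq_u.
    by apply: uc_inj; rewrite eq_u cx cy.
  rewrite -(card_in_imset u_inj).
  apply: leq_trans (_ : #|[set i : 'I_t.+1 | i < t]| <= _).
    apply/subset_leq_card/subsetP=> _ /imsetP[x /[!inE] /andP[ltx _] ->].
    by rewrite inordK // ltnS ltnW.
  apply: leq_trans (leq_imset_card (fun x => inord (r x) : 'I_t.+1) _).
  apply/subset_leq_card/subsetP=> i /[!inE] lt_it.
  have [y ry cy] := r_down (ltnW (leq_trans lt_it le_t_rz)).
  apply/imsetP; exists y; first by rewrite inE ry lt_it cy cz /=.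
  by apply: val_inj; rewrite /= ry inordK.
apply/subset_leq_card/subsetP=> x /[!inE] /andP[_ cx].
by rewrite cx andbT ltnNge; have := all_lt x; rewrite cx andbT.
Qed.

Let N := (\max_x c x).+1.

Lemma card_split_column (P : pred T) :
  #|[set x | P x]| = \sum_(j < N) #|[set x | P x & c x == j]|.
Proof.
rewrite -sum1_card (partition_big (fun x => inord (c x) : 'I_N) xpredT) //=.
apply: eq_bigr => j _; rewrite -sum1_card; apply: eq_bigl => x.
by rewrite !inE -val_eqE /= inordK // ltnS leq_bigmax.
Qed.

Lemma card_lt_dominated t : #|[set x | u x < t]| <= #|[set x | r x < t]|.
Proof.
by rewrite !card_split_column; apply: leq_sum => j _; apply: card_lt_column.
Qed.

Lemma sum_dominated : \sum_x r x <= \sum_x u x.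
Proof.
pose B := \max_x r x.
have countr x : r x = \sum_(t < B) (t < r x).
  by rewrite sum_ltn_minn; apply/esym/minn_idPr/leq_bigmax.
have countu x : \sum_(t < B) (t < u x) <= u x by rewrite sum_ltn_minn geq_minr.
rewrite (eq_bigr _ (fun x _ => countr x)).
apply: (@leq_trans (\sum_x \sum_(t < B) (t < u x))); last first.
  by apply: leq_sum => x _; apply: countu.
rewrite exchange_big [X in _ <= X]exchange_big /=; apply: leq_sum => t _.
have card_gt (v : T -> nat) :
    \sum_x (t < v x) = #|T| - #|[set x | v x < t.+1]|.
  rewrite -cardsT -cardsDS ?subsetT // -sum1_card -big_mkcond /=.
  by apply: eq_bigl => x; rewrite !inE ltnS -ltnNge andbT.
by rewrite !card_gt leq_sub2l ?card_lt_dominated.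
Qed.

(** Equality case of the dominance: if no count drops, the values of [u] on
    each column are exactly the row indices of that column. *)
Lemma cell_of_card_lt :
    (forall t, #|[set x | r x < t]| <= #|[set x | u x < t]|) ->
  forall x, exists2 y, r y = u x & c y = c x.
Proof.
move=> le_ru x.
case: (arg_maxnP (P := fun z => c z == c x) r (eqxx _)) => z /eqP cz max_z.
(* z is the last cell of the column of x. *)
suffices le_ux : u x <= r z.
  by have [y ry cy] := r_down le_ux; exists y; rewrite // cy cz.
have : #|[set y | u y < (r z).+1 & c y == c x]|
    == #|[set y | r y < (r z).+1 & c y == c x]|.
  have/leqif_sum: forall j : 'I_N, true ->
    #|[set y | u y < (r z).+1 & c y == j]|
    <= #|[set y | r y < (r z).+1 & c y == j]| ?=
    iff (#|[set y | u y < (r z).+1 & c y == j]|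
    == #|[set y | r y < (r z).+1 & c y == j]|).
    by move=> j _; split; first apply: card_lt_column.
  rewrite -!card_split_column => /leqifP.
  have /eqP eq_ur : #|[set y | u y < (r z).+1]| == #|[set y | r y < (r z).+1]|.
    by rewrite eqn_leq card_lt_dominated le_ru.
  case: ifP => [/forall_inP all_eq _ | _]; last by rewrite eq_ur ltnn.
  have lt_cx : c x < N by rewrite ltnS leq_bigmax.
  exact: all_eq (Ordinal lt_cx) isT.
have -> : [set y | r y < (r z).+1 & c y == c x] = [set y | c y == c x].
  apply/setP=> y; rewrite !inE; case: eqP => [cy|]; rewrite ?andbF // andbT.
  by rewrite ltnS; apply: max_z; rewrite cy.
move=> /eqP eq_card.
have sub : [set y | u y < (r z).+1 & c y == c x] \subset [set y | c y == c x].
  by apply/subsetP=> y; rewrite !inE => /andP[].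
have /eqP/setP/(_ x) : [set y | u y < (r z).+1 & c y == c x] == [set y | c y == c x].
  by rewrite eqEcard sub eq_card leqnn.
by rewrite !inE eqxx andbT ltnS.
Qed.

End Diagrams.

(** * Cells of the tableau of a partition *)

Section Tableaux.
Local Open Scope nat_scope.

Variables (n : nat) (lam : intpart n).

Lemma size_parts : size (parts lam) = n.
Proof. by rewrite size_map size_tuple. Qed.

Lemma sumn_parts : sumn (parts lam) = n.
Proof. by case: lam => t lamP; case/andP: (lamP) => _ /eqP. Qed.

Lemma parts_noninc i j : i <= j -> nth 0 (parts lam) j <= nth 0 (parts lam) i.
Proof.
have geq_trans : transitive geq by move=> a b c /= ba cb; apply: leq_trans cb ba.
have sorted_parts : sorted geq (parts lam).
  by case: lam => t lamP; case/andP: (lamP).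
have [lt_jn le_ij | le_nj _] := ltnP j (size (parts lam)); last first.
  by rewrite nth_default.
apply: (sorted_leq_nth geq_trans leqnn 0 sorted_parts) => //.
exact: leq_ltn_trans lt_jn.
Qed.

Lemma col_lt_parts x : col_of lam x < nth 0 (parts lam) (row_of lam x).
Proof. by apply: reshape_offsetP; rewrite sumn_parts. Qed.

Lemma row_lt x : row_of lam x < n.
Proof.
have := @reshape_indexP (parts lam) x.
by rewrite sumn_parts size_parts; apply.
Qed.

Lemma cell_exists i j :
  j < nth 0 (parts lam) i -> exists2 x, row_of lam x = i & col_of lam x = j.
Proof.
move=> lt_j; have lt_n := flatten_indexP lt_j; rewrite sumn_parts in lt_n.
exists (Ordinal lt_n); first exact: flatten_indexKl.
exact: flatten_indexKr.
Qed.

Lemma cell_inj x y :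
  row_of lam x = row_of lam y -> col_of lam x = col_of lam y -> x = y.
Proof.
move=> eq_row eq_col; apply: val_inj.
rewrite /= -(reshape_indexK (parts lam) x) -(reshape_indexK (parts lam) y).
by rewrite -/(row_of lam x) -/(col_of lam x) eq_row eq_col.
Qed.

Lemma row_down x i :
  i <= row_of lam x -> exists2 y, row_of lam y = i & col_of lam y = col_of lam x.
Proof.
by move=> le_i; apply/cell_exists/(leq_trans (col_lt_parts x))/parts_noninc.
Qed.

Lemma col_down x j :
  j <= col_of lam x -> exists2 y, col_of lam y = j & row_of lam y = row_of lam x.
Proof.
move=> le_j; have lt_j := leq_ltn_trans le_j (col_lt_parts x).
by have [y ry cy] := cell_exists lt_j; exists y.
Qed.

Lemma card_row i : #|[set x | row_of lam x == i]| = nth 0 (parts lam) i.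
Proof.
set m := nth _ _ _; rewrite -[RHS]card_ord.
have /fin_all_exists[f fP] (j : 'I_m) :
    exists x, row_of lam x = i /\ col_of lam x = j.
  have [x rx cx] := cell_exists (ltn_ord j).
  by exists x.
have f_inj : injective f.
  by move=> j1 j2 eq_f; apply: val_inj; rewrite /= -!(proj2 (fP _)) eq_f.
rewrite -(card_codom f_inj); apply: eq_card => x.
rewrite inE; apply/eqP/codomP => [rx | [j ->]]; last by case: (fP j).
have lt_j : col_of lam x < m by rewrite /m -rx col_lt_parts.
exists (Ordinal lt_j); have [rf cf] := fP (Ordinal lt_j).
by apply: cell_inj; rewrite ?rx ?rf ?cf.
Qed.

End Tableaux.

Lemma parts_inj n : injective (@parts n).
Proof.
move=> lam mu eq_parts; apply: val_inj; apply: val_inj.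
exact: inj_map val_inj _ _ eq_parts.
Qed.

Lemma card_ltS (T : finType) (r : T -> nat) t :
  #|[set x | r x < t.+1]%N| = (#|[set x | r x < t]%N| + #|[set x | r x == t]|)%N.
Proof.
have disj : [set x | r x < t]%N :&: [set x | r x == t] = set0.
  by apply/setP=> x; rewrite !inE; case: eqP => [->|]; rewrite ?ltnn ?andbF.
rewrite -cardsUI disj cards0 addn0.
by apply: eq_card => x; rewrite !inE ltnS leq_eqVlt orbC.
Qed.

Lemma eq_card_lt_rows n (lam mu : intpart n) :
    (forall t, #|[set x | row_of lam x < t]%N| = #|[set x | row_of mu x < t]%N|) ->
  lam = mu.
Proof.
move=> eq_lt; apply: parts_inj; apply: (@eq_from_nth _ 0%N) => [|t _].
  by rewrite !size_parts.
apply: (@addnI #|[set x | row_of lam x < t]%N|).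
by rewrite -!card_row {2}eq_lt -!card_ltS.
Qed.

Section Staircase.
Local Open Scope nat_scope.

Variable k : nat.
Let n := (k * k.+1)./2.

Lemma nth_staircase i : nth 0 (parts (staircase k)) i = k - i.
Proof.
have le_kn : k <= n.
  rewrite /n; case: (k) => // m.
  by rewrite -[leqLHS]doubleK half_leq // -muln2 leq_mul.
have [lt_in | le_ni] := ltnP i n; last first.
  rewrite nth_default ?size_parts //; apply/esym/eqP; rewrite subn_eq0.
  exact: leq_trans le_ni.
rewrite /parts (nth_map ord0) ?size_tuple //.
rewrite (nth_map (Ordinal lt_in)) ?size_enum_ord //.
rewrite [LHS]inordK nth_enum_ord //.
by rewrite ltnS (leq_trans (leq_subr _ _)).
Qed.

Lemma staircase_cell x :
  row_of (staircase k) x + col_of (staircase k) x < k.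
Proof. by have := col_lt_parts (staircase k) x; rewrite nth_staircase; lia. Qed.

Lemma card_row_staircase i : #|[set x | row_of (staircase k) x == i]| = k - i.
Proof. by rewrite card_row nth_staircase. Qed.

Lemma card_col_staircase j : #|[set x | col_of (staircase k) x == j]| = k - j.
Proof.
have /fin_all_exists[f fP] (x : 'I_n) : exists y,
    row_of (staircase k) y = col_of (staircase k) x
  /\ col_of (staircase k) y = row_of (staircase k) x.
  have [|y ry cy] := @cell_exists _ (staircase k) (col_of (staircase k) x)
                                    (row_of (staircase k) x); last by exists y.
  by rewrite nth_staircase; have := staircase_cell x; lia.
have f_inj : injective f.
  move=> x y eq_f; apply: (@cell_inj _ (staircase k)).
    by rewrite -!(proj2 (fP _)) eq_f.
  by rewrite -!(proj1 (fP _)) eq_f.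
rewrite -card_row_staircase.
rewrite -[RHS](on_card_preimset (onW_bij _ (injF_bij f_inj))).
by apply: eq_card => x; rewrite !inE (proj1 (fP x)).
Qed.

End Staircase.

(** * Coefficients of the Young symmetrizer *)

Section FiberStabilizers.

Variables (n : nat) (r : 'I_n -> nat).

Definition fstab : {set 'S_n} := [set s : 'S_n | [forall i, r (s i) == r i]].

Lemma fstabP (s : 'S_n) : reflect (forall i, r (s i) = r i) (s \in fstab).
Proof. by rewrite inE; apply: eqfunP. Qed.

Lemma group_set_fstab : group_set fstab.
Proof.
apply/group_setP; split=> [|s t /fstabP rs /fstabP rt].
  by apply/fstabP=> i; rewrite perm1.
by apply/fstabP=> i; rewrite permM rt rs.
Qed.
Canonical fstab_group := Group group_set_fstab.

Lemma tperm_fstab i j : r i = r j -> tperm i j \in fstab.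
Proof. by move=> rij; apply/fstabP=> l; case: tpermP => // ->. Qed.

(** Multiplication by a transposition of the stabilizer changes the sign of
    each term. *)
Lemma sum_sign_eq0 i j (F : 'S_n -> algC) :
    i != j -> r i = r j -> (forall s, F (tperm i j * s)%g = F s) ->
  \sum_(s in fstab) (-1) ^+ odd_perm s * F s = 0.
Proof.
move=> neq_ij rij F_inv; set S := LHS.
suffices S_opp : S = - S by apply/eqP; rewrite -eqNr -S_opp.
rewrite -sumrN /S (reindex_inj (mulgI (tperm i j))) /=.
apply: eq_big => s; first by rewrite groupMl ?tperm_fstab.
by move=> _; rewrite F_inv odd_mul_tperm neq_ij signr_addb mulN1r mulNr.
Qed.

End FiberStabilizers.

Section YoungCoefficients.

Variable n : nat.
Implicit Types (lam mu : intpart n) (x y p q : 'S_n).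

(** The coefficient of [x] in the Young symmetrizer, see [young_symE]. *)
Definition young_coef lam x : algC :=
  \sum_(p in row_stab lam) \sum_(q in col_stab lam)
    (-1) ^+ odd_perm q * (x == q * p)%g%:R.

(** The transformation law of the coefficients of an element of the form
    b_mu * t * a_lam of the group algebra. *)
Definition young_biinvariant lam mu (z : 'S_n -> algC) :=
  (forall q x, q \in col_stab mu -> z (q * x)%g = (-1) ^+ odd_perm q * z x)
  /\ (forall x p, p \in row_stab lam -> z (x * p)%g = z x).

Lemma young_coef_biinvariant lam : young_biinvariant lam lam (young_coef lam).
Proof.
split=> [q x Cq | x p Rp]; rewrite /young_coef.
  rewrite big_distrr; apply: eq_bigr => p _; rewrite big_distrr /=.
  rewrite (reindex_inj (mulgI q)) /=; apply: eq_big => q'.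
    exact: (@groupMl _ (fstab_group (col_of lam))).
  by rewrite odd_permM signr_addb -mulgA (inj_eq (mulgI q)) mulrA.
rewrite (reindex_inj (mulIg p)) /=; apply: eq_big => p'.
  exact: (@groupMr _ (fstab_group (row_of lam))).
by move=> _; apply: eq_bigr => q _; rewrite mulgA (inj_eq (mulIg p)).
Qed.

(** If two points share a column of mu and their images under [x] share a row
    of lam, the transposition [t] of these points satisfies t x = x t' with t'
    in the row stabilizer, so that z x = - z x. *)
Lemma biinvariant_eq0 lam mu z x :
    young_biinvariant lam mu z ->
    ~ injective (fun i => (row_of lam (x i), col_of mu i)) ->
  z x = 0.
Proof.
move=> [z_col z_row] /injectiveP/injectivePn[i [j neq_ij [eq_row eq_col]]].
pose t := tperm i j.
have odd_t : odd_perm t by rewrite odd_tperm.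
have : z (t * x)%g = z (x * t ^ x)%g by rewrite -conjgC.
rewrite z_col ?(@tperm_fstab _ (col_of mu)) // tpermJ.
rewrite z_row ?(@tperm_fstab _ (row_of lam)) // odd_t mulN1r.
move/eqP; rewrite eq_sym -subr_eq0 opprK -mulr2n mulrn_eq0 /=.
exact: eqP.
Qed.

Lemma card_perm_lt (x : 'S_n) (r : 'I_n -> nat) t :
  #|[set i | r (x i) < t]%N| = #|[set i | r i < t]%N|.
Proof.
rewrite -[RHS](on_card_preimset (onW_bij _ (injF_bij (@perm_inj _ x)))).
by apply: eq_card => i; rewrite !inE.
Qed.

(** By the equality case of dominance, some column permutation [q] brings each
    point to the row that [x] assigns to it. *)
Lemma young_factor lam x :
    injective (fun i => (row_of lam (x i), col_of lam i)) ->
  exists q p, [/\ q \in col_stab lam, p \in row_stab lam & x = (q * p)%g].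
Proof.
move=> inj_x.
have /fin_all_exists2[f f_row f_col] := cell_of_card_lt
  (@row_down n lam) inj_x (fun t => eq_leq (esym (card_perm_lt x _ t))).
have f_inj : injective f.
  by move=> i j eq_f; apply: inj_x; rewrite -2!f_row -(f_col i) -(f_col j) eq_f.
pose q := perm f_inj; exists q, (q^-1 * x)%g; split; last by rewrite mulKVg.
  by apply/(@fstabP _ (col_of lam)) => i; rewrite permE f_col.
apply/(@fstabP _ (row_of lam)) => i; rewrite permM -f_row.
by rewrite -[f _](permE f_inj) permKV.
Qed.

(** A permutation preserving both rows and columns is the identity. *)
Lemma young_coef1 lam : young_coef lam 1%g = 1.
Proof.
rewrite /young_coef (bigD1 1%g) ?(group1 (fstab_group (row_of lam))) //=.
rewrite (bigD1 1%g) ?(group1 (fstab_group (col_of lam))) //=.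
rewrite odd_perm1 mulg1 eqxx mulr1 !big1 ?addr0 // => [p|q].
  case/andP=> Rp p_neq1; apply: big1 => q Cq.
  rewrite (introF eqP) ?mulr0 // => eq1; case/eqP: p_neq1.
  apply/permP=> i; rewrite perm1; apply: (@cell_inj _ lam).
    exact: (@fstabP _ (row_of lam)).
  have qE : p = (q^-1)%g by apply/eqP; rewrite eq_sym eq_invg_mul -eq1.
  apply: (@fstabP _ (col_of lam)).
  by rewrite qE (groupV (fstab_group (col_of lam))).
by case/andP=> _ q_neq1; rewrite mulg1 eq_sym (negbTE q_neq1) mulr0.
Qed.

Lemma biinvariantE lam z x :
  young_biinvariant lam lam z -> z x = z 1%g * young_coef lam x.
Proof.
move=> bi_z; have [bz_col bz_row] := bi_z.
have bi_c := young_coef_biinvariant lam; have [bc_col bc_row] := bi_c.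
have [/injectiveP/young_factor[q [p [Cq Rp ->]]] | /injectiveP not_inj] :=
    boolP (injectiveb (fun i => (row_of lam (x i), col_of lam i))).
  by rewrite bz_row // bc_row // -[q]mulg1 bz_col // bc_col //
    young_coef1 mulr1 mulrC.
by rewrite (biinvariant_eq0 bi_z) // (biinvariant_eq0 bi_c) // mulr0.
Qed.

Lemma sandwich_biinvariant lam mu x :
  young_biinvariant lam mu
    (fun y => \sum_g young_coef mu g * young_coef lam (x * g^-1 * y)%g).
Proof.
have [mu_col _] := young_coef_biinvariant mu.
have [_ lam_row] := young_coef_biinvariant lam.
split=> [q y Cq | y p Rp].
  rewrite (reindex_inj (mulgI q)) big_distrr /=; apply: eq_bigr => g _.
  rewrite mu_col // -mulrA; congr (_ * (_ * young_coef lam _)).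
  by rewrite invMg !mulgA mulgKV.
by apply: eq_bigr => g _; rewrite mulgA (lam_row _ p).
Qed.

(** The scalar h such that c * c = h c, where c is the Young symmetrizer; it is
    the coefficient of 1 in c * c. *)
Definition young_const lam : algC :=
  \sum_g young_coef lam g * young_coef lam g^-1%g.

(** The product c * c is transformed like c, hence is a multiple of it. *)
Lemma young_coef_conv lam x :
  \sum_g young_coef lam g * young_coef lam (g^-1 * x)%g
    = young_const lam * young_coef lam x.
Proof.
have := biinvariantE x (sandwich_biinvariant lam lam 1).
under eq_bigr do rewrite mul1g; move=> ->; congr (_ * _).
by apply: eq_bigr => g _; rewrite mul1g mulg1.
Qed.

(** This is the identity c * x^-1 * c = h c(x) c in coordinates. *)
Lemma young_sandwich lam x y :
  \sum_g young_coef lam g * young_coef lam (x * g^-1 * y)%g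
    = young_const lam * young_coef lam x * young_coef lam y.
Proof.
rewrite (biinvariantE y (sandwich_biinvariant lam lam x)); congr (_ * _).
rewrite -young_coef_conv (reindex_inj invg_inj) (reindex_inj (mulgI x^-1%g)) /=.
by apply: eq_bigr => g _; rewrite mulg1 !invgK invMg invgK mulKVg mulrC.
Qed.

(** The sum is a coefficient of b_mu a_mu * t * b_lam a_lam for some t, and
    such a product vanishes unless mu dominates lam. *)
Lemma young_sandwich_eq0 lam mu t x y :
    (#|[set i | row_of mu i < t]| < #|[set i | row_of lam i < t]|)%N ->
  \sum_g young_coef mu g * young_coef lam (x * g^-1 * y)%g = 0.
Proof.
move=> lt_t; apply: (biinvariant_eq0 (sandwich_biinvariant lam mu x)) => inj_y.
have := card_lt_dominated (@row_down n mu) inj_y t.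
by rewrite card_perm_lt leqNgt lt_t.
Qed.

End YoungCoefficients.

(** * The characters of the symmetric group *)

(** With A = C R a full rank factorization, A A = 0 forces R C = 0. *)
Lemma mxtrace_sqr0 (F : fieldType) m (A : 'M[F]_m) : A *m A = 0 -> \tr A = 0.
Proof.
rewrite -{1 2 3}(mulmx_base A) => sqA0.
suffices RC0 : row_base A *m col_base A = 0.
  by rewrite mxtrace_mulC RC0 linear0.
apply: (row_free_inj (row_base_free A)); rewrite mul0mx.
have full_C : row_free (col_base A)^T.
  by rewrite /row_free mxrank_tr; apply: col_base_full.
apply: trmx_inj; apply: (row_free_inj full_C).
by rewrite -!trmx_mul mulmx0 -sqA0 !mulmxA.
Qed.

(** L / h is a projection on U commuting with the action, so the trace of g on
    U is the trace of g L / h on the whole space. *)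
Lemma cfRepr_submod_scaled_proj (gT : finGroupType) (G : {group gT}) m
    (rG : mx_representation algC G m) (U L : 'M_m)
    (modU : mxmodule rG U) (h : algC) g :
    (L :=: U)%MS -> centgmx rG L -> h != 0 -> L *m L = h *: L -> g \in G ->
  cfRepr (submod_repr modU) g = h^-1 * \tr (rG g *m L).
Proof.
move=> eqLU /centgmxP cL nz_h sqL Gg; rewrite cfunE Gg mulr1n /=.
pose e := h^-1 *: L.
have idU (W : 'M_(\rank U, m)) : (W <= U)%MS -> W *m e = W.
  rewrite -eqLU => /submxP[w ->].
  by rewrite /e -scalemxAr -mulmxA sqL -scalemxAr scalerA mulVf ?scale1r.
have e_sub : (e <= U)%MS by rewrite -eqLU scalemx_sub.
have cE : rG g *m e = e *m rG g by rewrite /e -scalemxAr -cL // -scalemxAl.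
have ePB : e *m in_submod U 1%:M *m val_submod 1%:M = e.
  by rewrite -in_submodE -val_submodE in_submodK.
rewrite /submod_mx in_submodE -{1}[val_submod 1%:M]idU ?val_submodP //.
move: (in_submod U 1%:M) (val_submod 1%:M) ePB => P B ePB.
rewrite -(mulmxA B) -cE -mulmxA mxtrace_mulC -!mulmxA (mulmxA e) ePB.
by rewrite /e -scalemxAr linearZ.
Qed.

Section YoungCharacters.

Variable n : nat.
Implicit Types (lam mu : intpart n) (x y g : 'S_n).
Local Notation G := [set: 'S_n]%G.
Local Notation aG := (regular_repr algC G).
Local Notation gvec x := (delta_mx 0 (gring_index G x) : 'rV[algC]_#|G|).

Lemma gvecM x y : gvec x *m aG y = gvec (x * y).
Proof. by rewrite -rowE rowK gring_indexK ?inE. Qed.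

Lemma young_symE lam : young_sym lam = \sum_x young_coef lam x *: gvec x.
Proof.
rewrite /young_sym /young_coef; under [RHS]eq_bigr do rewrite scaler_suml.
rewrite [RHS]exchange_big; apply: eq_bigr => p _ /=.
under [RHS]eq_bigr do rewrite scaler_suml.
rewrite [RHS]exchange_big; apply: eq_bigr => q _ /=.
rewrite (bigD1 (q * p)%g) //= eqxx mulr1 big1 ?addr0 // => x /negbTE->.
by rewrite mulr0 scale0r.
Qed.

(** The matrix, acting on rows, of left multiplication by the Young symmetrizer;
    its row space is the ideal that affords the character. *)
Definition young_mx lam : 'M[algC]_#|G| :=
  enveloping_algebra_mx aG *m lin_mul_row (young_sym lam).

Lemma gvec_young lam x : gvec x *m young_mx lam = young_sym lam *m aG x.
Proof.
by rewrite mulmxA -rowE rowK mul_rV_lin1 /= mxvecK gring_indexK ?inE.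
Qed.

Lemma gvecP (A B : 'M[algC]_#|G|) :
  (forall x, gvec x *m A = gvec x *m B) -> A = B.
Proof.
move=> eqAB; apply/row_matrixP=> i; rewrite !rowE -(gring_valK i).
exact: eqAB.
Qed.

Lemma young_mx_cent lam : centgmx aG (young_mx lam).
Proof.
apply/centgmxP=> x _; apply: gvecP => y.
rewrite [LHS]mulmxA [RHS]mulmxA gvecM !gvec_young -mulmxA -repr_mxM ?inE //.
Qed.

Lemma young_mx_sqr lam :
  young_mx lam *m young_mx lam = young_const lam *: young_mx lam.
Proof.
apply: gvecP => x; rewrite [LHS]mulmxA gvec_young -[LHS]mulmxA.
rewrite -(centgmxP (young_mx_cent lam)) ?inE // [LHS]mulmxA.
rewrite -scalemxAr gvec_young scalemxAl; congr (_ *m _).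
rewrite young_symE mulmx_suml.
under eq_bigr => y _ do
  rewrite -scalemxAl gvec_young young_symE mulmx_suml scaler_sumr.
rewrite exchange_big scaler_sumr /=.
transitivity (\sum_w (\sum_z young_coef lam z * young_coef lam (z^-1 * w)%g)
                     *: gvec w).
  under [RHS]eq_bigr do rewrite scaler_suml.
  rewrite [RHS]exchange_big; apply: eq_bigr => z _ /=.
  rewrite [RHS](reindex_inj (mulgI z)); apply: eq_bigr => y _.
  by rewrite -scalemxAl gvecM scalerA mulKg mulrC.
by apply: eq_bigr => w _; rewrite young_coef_conv scalerA.
Qed.

Lemma mxtrace_young lam g :
  \tr (aG g *m young_mx lam) = \sum_x young_coef lam (x * g^-1 * x^-1)%g.
Proof.
have bij_index : bijective (gring_index G).
  exists (@enum_val _ (mem G)) => [x|]; last exact: gring_valK.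
  by rewrite gring_indexK ?inE.
rewrite /mxtrace (reindex (gring_index G)) /=; last exact: onW_bij.
apply: eq_bigr => x _.
have -> : (aG g *m young_mx lam) (gring_index G x) (gring_index G x)
    = (gvec x *m (aG g *m young_mx lam)) 0 (gring_index G x).
  by rewrite -rowE [RHS]mxE.
rewrite [_ *m _]mulmxA gvecM gvec_young young_symE mulmx_suml summxE.
have entry y : (young_coef lam y *: gvec y *m aG (x * g)%g) 0 (gring_index G x)
    = young_coef lam y * (y == x * g^-1 * x^-1)%g%:R.
  rewrite -scalemxAl gvecM mxE mxE eqxx /= (inj_eq (bij_inj bij_index)).
  by rewrite -(inj_eq (mulIg (x * g)%g) y) !mulgA mulgKV mulgKV eq_sym.
under eq_bigr do rewrite entry.
rewrite (bigD1 (x * g^-1 * x^-1)%g) //= eqxx mulr1 big1 ?addr0 // => y.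
by move/negbTE->; rewrite mulr0.
Qed.

(** Otherwise left multiplication by c would have square 0 and hence trace 0,
    but its trace is n! times the coefficient of 1 in c. *)
Lemma young_const_neq0 lam : young_const lam != 0.
Proof.
apply/eqP=> h0; have := young_mx_sqr lam; rewrite h0 scale0r.
move/mxtrace_sqr0/eqP; rewrite -[young_mx lam]mul1mx -(repr_mx1 aG).
rewrite mxtrace_young invg1.
under eq_bigr do rewrite mulg1 mulgV young_coef1.
by rewrite sumr_const pnatr_eq0 -cardsT eqn0Ngt cardG_gt0.
Qed.

Lemma sym_charE lam g :
  sym_char lam g
    = (young_const lam)^-1 * \sum_x young_coef lam (x * g^-1 * x^-1)%g.
Proof.
rewrite -mxtrace_young; apply: cfRepr_submod_scaled_proj.
- exact/eqmx_sym/genmxE.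
- exact: young_mx_cent.
- exact: young_const_neq0.
- exact: young_mx_sqr.
by rewrite inE.
Qed.

Lemma sym_char_char lam : sym_char lam \is a character.
Proof. exact: cfRepr_char. Qed.

(** Averaging over conjugates is absorbed by the class function [psi]. *)
Lemma cfdot_sym_char (psi : 'CF(G)) lam :
  '[psi, sym_char lam] = (young_const lam)^-1 * \sum_g psi g * young_coef lam g.
Proof.
have term g : psi g * (sym_char lam g)^* = (young_const lam)^-1
    * \sum_x psi (x * g * x^-1)%g * young_coef lam (x * g * x^-1)%g.
  rewrite -char_inv ?sym_char_char // sym_charE invgK mulrCA big_distrr /=.
  congr (_ * _); apply: eq_bigr => x _; congr (_ * _).
  by rewrite -mulgA -{1}[x]invgK -conjgE cfunJ // inE.
rewrite cfdotE (eq_bigl xpredT) => [|g]; last by rewrite inE.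
under eq_bigr do rewrite term.
rewrite -big_distrr mulrCA exchange_big /=; congr (_ * _).
have sum_conj x : \sum_g psi (x * g * x^-1)%g * young_coef lam (x * g * x^-1)%g
    = \sum_g psi g * young_coef lam g.
  rewrite (reindex_inj (conjg_inj x)) /=; apply: eq_bigr => g _.
  by rewrite conjgE !mulgA mulgV mul1g mulgK.
under eq_bigr do rewrite sum_conj.
rewrite sumr_const -cardsT -[X in _ * X = _]mulr_natl.
by apply: mulKf; rewrite pnatr_eq0 eqn0Ngt cardG_gt0.
Qed.

Lemma cfdot_sym_char2 lam mu :
  '[sym_char lam, sym_char mu]
    = (young_const mu)^-1 * (young_const lam)^-1 *
      \sum_x \sum_g young_coef mu g * young_coef lam (x * g^-1 * x^-1)%g.
Proof.
rewrite cfdot_sym_char -mulrA; congr (_ * _).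
rewrite exchange_big big_distrr /=; apply: eq_bigr => g _.
by rewrite sym_charE -mulrA big_distrl /=; under [in RHS]eq_bigr do rewrite mulrC.
Qed.

Lemma sym_char_irr lam : sym_char lam \in irr G.
Proof.
rewrite irrEchar sym_char_char /= cfdot_sym_char2.
under eq_bigr do rewrite young_sandwich -mulrA.
rewrite -big_distrr /= -/(young_const lam).
by rewrite -mulrA mulKf ?mulVf ?young_const_neq0.
Qed.

Lemma cfdot_sym_char_eq0 lam mu t :
    (#|[set i | row_of mu i < t]| < #|[set i | row_of lam i < t]|)%N ->
  '[sym_char lam, sym_char mu] = 0.
Proof.
move=> lt_t; rewrite cfdot_sym_char2 big1 ?mulr0 // => x _.
exact: young_sandwich_eq0 lt_t.
Qed.

(** Two distinct partitions do not dominate each other both ways. *)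
Lemma cfdot_sym_charE lam mu :
  '[sym_char lam, sym_char mu] = (lam == mu)%:R.
Proof.
have [<- | /eqP neq] := eqVneq.
  by apply/eqP; have := sym_char_irr lam; rewrite irrEchar => /andP[].
case: (boolP [forall t : 'I_n.+1, #|[set i | row_of mu i < t]|
                           == #|[set i | row_of lam i < t]|])%N.
  move=> /forallP eq_lt; case: neq; apply: eq_card_lt_rows => t.
  have [lt_tn|] := ltnP t n.+1; first by have /eqP := eq_lt (Ordinal lt_tn).
  move=> le_nt; apply: eq_card => i; rewrite !inE.
  by rewrite !(leq_trans (row_lt _ i)) // ltnW.
case/forallPn=> t; rewrite neq_ltn => /orP[lt_t | lt_t].
  exact: cfdot_sym_char_eq0 lt_t.
by rewrite cfdotC (cfdot_sym_char_eq0 lt_t) conjC0.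
Qed.

End YoungCharacters.

(** * Completeness: conjugacy classes and partitions *)

Section ConjugatePermutations.
Local Open Scope nat_scope.

Variable T : finType.
Implicit Types (g : {perm T}) (x y : T).

Lemma iter_mod_order g x m : iter (m %% fingraph.order g x) g x = iter m g x.
Proof.
rewrite [in RHS](divn_eq m (fingraph.order g x)) addnC iterD.
by elim: (m %/ _) => //= q IHq; rewrite mulSnr iterD iter_order //; apply: perm_inj.
Qed.

(** Elements with the same [o]-value are matched through their positions in the
    enumerations of the two fibers. *)
Lemma matching_bijection (A A' : {set T}) (o o' : T -> nat) :
    (forall d, #|[set x in A | o x == d]| = #|[set x in A' | o' x == d]|) ->
  exists b : T -> T, {in A, forall x, b x \in A' /\ o' (b x) = o x}
    /\ {in A &, injective b}.
Proof.
move=> eq_card_d.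
pose E d := enum [set x in A | o x == d].
pose E' d := enum [set x in A' | o' x == d].
have memE x : x \in A -> x \in E (o x) by move=> Ax; rewrite mem_enum inE Ax eqxx.
have lt_index x : x \in A -> index x (E (o x)) < size (E' (o x)).
  by move=> Ax; rewrite -cardE -eq_card_d cardE index_mem memE.
pose b x := nth x (E' (o x)) (index x (E (o x))).
have bP x : x \in A -> b x \in A' /\ o' (b x) = o x.
  move=> Ax; have := mem_nth x (lt_index x Ax); rewrite -/(b x) mem_enum inE.
  by case/andP=> -> /eqP->.
exists b; split=> // x y Ax Ay eq_b.
have eq_o : o x = o y by rewrite -(proj2 (bP x Ax)) eq_b (proj2 (bP y Ay)).
have lt_x := lt_index x Ax; have lt_y := lt_index y Ay.
move: eq_b; rewrite /b -eq_o in lt_y *; rewrite (set_nth_default y) // => /eqP.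
rewrite nth_uniq ?enum_uniq // => /eqP eq_i.
rewrite -(nth_index x (memE x Ax)) eq_i nth_index // eq_o; exact: memE.
Qed.

Definition cycle_reps g := [set x | froots g x].

(** Match the cycles of [g] and [h] by length, then map the m-th iterate of the
    representative of a cycle to the m-th iterate of its partner. *)
Lemma conj_of_cycle_counts g h :
    (forall d, #|[set x in cycle_reps g | fingraph.order g x == d]|
             = #|[set x in cycle_reps h | fingraph.order h x == d]|) ->
  exists s, h = (g ^ s)%g.
Proof.
move=> /matching_bijection[b [bP b_inj]].
have g_sym := fconnect_sym (@perm_inj _ g).
have h_sym := fconnect_sym (@perm_inj _ h).
pose s x := iter (findex g (froot g x) x) h (b (froot g x)).
have rootsP x : froot g x \in cycle_reps g by rewrite inE roots_root.
have decomp x : exists r m,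
    [/\ r \in cycle_reps g, m < fingraph.order g r & x = iter m g r].
  exists (froot g x), (findex g (froot g x) x).
  have conn : fconnect g (froot g x) x by rewrite g_sym connect_root.
  by split; [exact: rootsP | exact: findex_max | rewrite iter_findex].
have sE r m : r \in cycle_reps g -> s (iter m g r) = iter m h (b r).
  move=> Ar; have [_ ord_r] := bP r Ar.
  rewrite -iter_mod_order -[RHS]iter_mod_order ord_r.
  have lt_m : m %% fingraph.order g r < fingraph.order g r.
    by rewrite ltn_mod fingraph.order_gt0.
  have root_r : froot g (iter (m %% fingraph.order g r) g r) = r.
    rewrite -(elimT (fingraph.rootP g_sym) (fconnect_iter _ _ _)).
    by move: Ar; rewrite inE => /eqP.
  by rewrite /s root_r findex_iter.
have s_inj : injective s.
  move=> x y; have [r [m [Ar lt_m ->]]] := decomp x.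
  have [r' [m' [Ar' lt_m' ->]]] := decomp y.
  rewrite !sE // => eq_s.
  have eq_r : r = r'.
    apply: b_inj => //; have [Br _] := bP r Ar; have [Br' _] := bP r' Ar'.
    move: Br Br'; rewrite !inE => /eqP<- /eqP<-; apply/(fingraph.rootP h_sym).
    apply: connect_trans (fconnect_iter h m (b r)) _.
    by rewrite eq_s h_sym fconnect_iter.
  subst r'; have [_ ord_r] := bP r Ar.
  have := findex_iter (f := h) (x := b r) (i := m); rewrite ord_r => /(_ lt_m).
  by rewrite eq_s findex_iter ?ord_r // => ->.
exists (perm s_inj); apply/permP=> y.
have [x ->] : exists x, y = s x.
  by exists (((perm s_inj)^-1)%g y); rewrite -[s _](permE s_inj) permKV.
rewrite conjgE !permM -[X in ((perm s_inj)^-1)%g X](permE s_inj) permK permE.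
have [r [m [Ar lt_m ->]]] := decomp x.
by rewrite -iterS !sE.
Qed.

(** As a function of [i], this is the conjugate of the partition formed by the
    cycle lengths; it is nonincreasing, so it gives a partition without any
    sorting. *)
Definition long_cycles g i := #|[set x in cycle_reps g | i < fingraph.order g x]|.

Lemma long_cycles_conj g h :
  (forall i, long_cycles g i = long_cycles h i) -> exists s, h = (g ^ s)%g.
Proof.
move=> eq_long; apply: conj_of_cycle_counts => -[|d].
  by rewrite !eq_card0 // => x; rewrite !inE gtn_eqF ?fingraph.order_gt0 ?andbF.
have split_long k : long_cycles k d
    = #|[set x in cycle_reps k | fingraph.order k x == d.+1]| + long_cycles k d.+1.
  have disj : [set x in cycle_reps k | fingraph.order k x == d.+1]
      :&: [set x in cycle_reps k | d.+1 < fingraph.order k x] = set0.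
    apply/setP=> x; rewrite !inE.
    by case: eqP => [->|]; rewrite ?ltnn ?andbF.
  rewrite /long_cycles -cardsUI disj cards0 addn0; apply: eq_card => x.
  by rewrite !inE -andb_orr leq_eqVlt eq_sym.
by apply: (@addIn (long_cycles g d.+1)); rewrite -split_long eq_long split_long eq_long.
Qed.

Lemma long_cycles_eq0 g i : #|T| <= i -> long_cycles g i = 0.
Proof.
move=> le_Ti; apply: eq_card0 => x; rewrite !inE ltnNge.
by rewrite (leq_trans (max_card _) le_Ti) andbF.
Qed.

Lemma sum_long_cycles g : \sum_(i < #|T|) long_cycles g i = #|T|.
Proof.
have g_sym := fconnect_sym (@perm_inj _ g).
transitivity (\sum_(x in cycle_reps g) fingraph.order g x).
  transitivity (\sum_(i < #|T|) \sum_(x in cycle_reps g) (i < fingraph.order g x)).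
    apply: eq_bigr => i _; rewrite -big_mkcondr /= sum1dep_card.
    by apply: eq_card => x; rewrite inE.
  rewrite exchange_big /=; apply: eq_bigr => x _.
  by rewrite sum_ltn_minn; apply/minn_idPr; rewrite /fingraph.order max_card.
rewrite -[RHS]sum1_card [RHS](partition_big (froot g) (mem (cycle_reps g))) /=; last first.
  by move=> x _; rewrite inE roots_root.
apply: eq_bigr => r; rewrite inE => /eqP root_r.
rewrite sum1dep_card /fingraph.order; apply: eq_card => x; rewrite !inE.
by rewrite -(root_connect g_sym) root_r eq_sym.
Qed.

End ConjugatePermutations.

Section Completeness.

Variable n : nat.
Local Notation G := [set: 'S_n]%G.

Lemma map_long_cycles (g : 'S_n) :
  [seq val i | i <- [tuple inord (long_cycles g i) : 'I_n.+1 | i < n]]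
    = [seq long_cycles g i | i <- iota 0 n].
Proof.
rewrite /= -map_comp -val_enum_ord -map_comp; apply: eq_map => i /=.
by rewrite inordK // ltnS -[leqRHS]card_ord max_card.
Qed.

Fact cycle_type_subproof (g : 'S_n) :
  is_intpart [tuple inord (long_cycles g i) : 'I_n.+1 | i < n].
Proof.
rewrite /is_intpart map_long_cycles; apply/andP; split.
  apply: (@homo_sorted _ _ (long_cycles g) leq geq) => [i j le_ij|].
    apply/subset_leq_card/subsetP=> x; rewrite !inE => /andP[->].
    exact: leq_ltn_trans.
  exact: iota_sorted.
rewrite sumnE big_map.
have -> : iota 0 n = index_iota 0 n by rewrite /index_iota subn0.
by rewrite big_mkord -[X in _ == X]card_ord -(sum_long_cycles g) card_ord.
Qed.

Definition cycle_type (g : 'S_n) : intpart n := IntPart (cycle_type_subproof g).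

Lemma parts_cycle_type (g : 'S_n) :
  parts (cycle_type g) = [seq long_cycles g i | i <- iota 0 n].
Proof. exact: map_long_cycles. Qed.

Lemma cycle_type_conj (g h : 'S_n) :
  cycle_type g = cycle_type h -> exists s, h = (g ^ s)%g.
Proof.
move=> /(congr1 (@parts n)); rewrite !parts_cycle_type.
move=> /eq_in_map eq_long; apply: long_cycles_conj => i.
have [lt_in | le_ni] := ltnP i n; first by apply: eq_long; rewrite mem_iota.
by rewrite !long_cycles_eq0 ?card_ord.
Qed.

Lemma card_classes_le : (#|classes G| <= #|{: intpart n}|)%N.
Proof.
have repr_inj : {in classes G &, injective (fun C => cycle_type (repr C))}.
  move=> C D /repr_classesP[_ defC] /repr_classesP[_ defD].
  by case/cycle_type_conj=> s eq_repr; rewrite defC defD eq_repr classGidl ?inE.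
by rewrite -(card_in_imset repr_inj) max_card.
Qed.

Lemma irr_is_sym_char (i : Iirr G) : exists lam, 'chi_i = sym_char lam.
Proof.
have /fin_all_exists[f fP] (lam : intpart n) : exists i, sym_char lam = 'chi[G]_i.
  by have /irrP := sym_char_irr lam.
have f_inj : injective f.
  move=> lam mu eq_f; apply/eqP; have := cfdot_sym_charE lam mu.
  rewrite !fP eq_f cfdot_irr eqxx; case: eqP => // _ /eqP.
  by rewrite oner_eq0.
have /(inj_card_onto f_inj)/(_ i)/codomP[lam ->] :
    (#|Iirr G| <= #|{: intpart n}|)%N.
  by rewrite card_ord NirrE card_classes_le.
by exists lam; rewrite fP.
Qed.

(** The product lies in the span of the irreducible characters, and these are
    all of the form [nu]; orthonormality then isolates the coordinate. *)
Lemma kroneckerE (lam mu nu : intpart n) :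
  kronecker lam mu nu = '[sym_char lam * sym_char mu, sym_char nu].
Proof.
rewrite /kronecker; set X := [tuple _ | i < _]; set v := _ * _.
have Xv : v \in <<X>>%VS.
  rewrite [v]cfun_sum_cfdot; apply: memv_suml => i _; apply: memvZ.
  have [rho ->] := irr_is_sym_char i; apply: memv_span.
  apply/tnthP; exists (enum_rank rho).
  by rewrite tnth_mktuple enum_rankK.
rewrite [in RHS](coord_span Xv) cfdot_suml (bigD1 (enum_rank nu)) //=.
have nthX (i : 'I_#|intpart n|) : X`_i = sym_char (enum_val i).
  by rewrite -tnth_nth tnth_mktuple.
rewrite big1 ?addr0 => [|i neq_i]; rewrite nthX cfdotZl cfdot_sym_charE.
  by rewrite enum_rankK eqxx mulr1.
rewrite (_ : (_ == _) = false) ?mulr0 //; apply: contraNF neq_i => /eqP<-.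
by rewrite enum_valK.
Qed.

End Completeness.

(** * The alternating square of a character *)

Section AlternatingSquare.

Section Minors.

Variables (R : comNzRingType) (n : nat).
Implicit Types (A B : 'M[R]_n) (p q : 'I_n * 'I_n).

Definition minor2 A p q := A p.1 q.1 * A p.2 q.2 - A p.1 q.2 * A p.2 q.1.

Definition ltpairs : {set 'I_n * 'I_n} :=
  [set p : 'I_n * 'I_n | p.1 < p.2]%N.

(** The second compound matrix, that is, the action of [A] on the exterior
    square. *)
Definition alt_mx A : 'M[R]_#|ltpairs| :=
  \matrix_(i, j) minor2 A (enum_val i) (enum_val j).

Lemma sum_ltpairs (F : 'I_n * 'I_n -> R) :
    (forall i, F (i, i) = 0) ->
  \sum_i \sum_j F (i, j) = \sum_(p in ltpairs) (F p + F (p.2, p.1)).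
Proof.
move=> F0; rewrite pair_bigA /=.
rewrite (bigID (fun p : 'I_n * 'I_n => p.1 < p.2)%N) big_split /=.
congr (_ + _); first by apply: eq_big => [|[i j]] // [i j]; rewrite inE.
rewrite (bigID (fun p : 'I_n * 'I_n => p.1 == p.2)) /= big1 ?add0r; last first.
  by case=> i j /andP[_ /eqP /= ->].
have swapK : involutive (fun p : 'I_n * 'I_n => (p.2, p.1)) by case.
rewrite (reindex_inj (inv_inj swapK)) /=.
apply: eq_big => [[i j]|[i j]] //=; rewrite inE /= -leqNgt ltn_neqAle andbC.
by rewrite eq_sym.
Qed.

(** The Cauchy-Binet formula for minors of order 2. *)
Lemma alt_mxM A B : alt_mx (A *m B) = alt_mx A *m alt_mx B.
Proof.
apply/matrixP=> i j; rewrite !mxE.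
set p := enum_val i; set r := enum_val j.
transitivity (\sum_k \sum_l A p.1 k * A p.2 l * minor2 B (k, l) r).
  rewrite /minor2 !mxE !big_distrlr -sumrB; apply: eq_bigr => k _.
  by rewrite -sumrB; apply: eq_bigr => l _ /=; ring.
rewrite (sum_ltpairs (F := fun q => A p.1 q.1 * A p.2 q.2 * minor2 B q r)); last first.
  by move=> k; rewrite /minor2 /= [X in _ - X]mulrC subrr mulr0.
rewrite big_enum_val; apply: eq_bigr => q _; rewrite !mxE -/p -/r /minor2 /=.
by ring.
Qed.

Lemma alt_mx1 : alt_mx 1%:M = 1%:M.
Proof.
apply/matrixP=> i j; rewrite !mxE /minor2 !mxE -(inj_eq enum_val_inj).
have := enum_valP i; have := enum_valP j.
move: (enum_val i) (enum_val j) => [a b] [c d]; rewrite !inE /= => lt_cd lt_ab.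
rewrite xpair_eqE -!natrM !mulnb.
have -> : (a == d) && (b == c) = false.
  by apply/andP=> -[/eqP ad /eqP bc]; rewrite ad bc ltnNge ltnW in lt_ab.
by rewrite subr0.
Qed.

Lemma mxtrace_alt A : \tr (alt_mx A) *+ 2 = \tr A ^+ 2 - \tr (A *m A).
Proof.
have -> : \tr A ^+ 2 - \tr (A *m A) = \sum_i \sum_j minor2 A (i, j) (i, j).
  rewrite /mxtrace expr2 big_distrlr -sumrB; apply: eq_bigr => i _.
  by rewrite mxE -sumrB.
rewrite (sum_ltpairs (F := fun q => minor2 A q q)); last first.
  by move=> k; rewrite /minor2 /= subrr.
rewrite big_enum_val -sumrMnl; apply: eq_bigr => i _.
by rewrite mxE /minor2 /=; ring.
Qed.

End Minors.

Variables (gT : finGroupType) (G : {group gT}).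

Lemma alt_square_char (chi : 'CF(G)) :
  chi \is a character -> alt_square chi \is a character.
Proof.
case/char_reprP=> -[m rG] ->.
have alt_repr : mx_repr G (fun x => alt_mx (rG x)).
  by split=> [|x y Gx Gy]; rewrite ?repr_mx1 ?alt_mx1 // repr_mxM // alt_mxM.
rewrite (_ : alt_square _ = cfRepr (MxRepresentation alt_repr)) ?cfRepr_char //.
apply/cfun_inP=> x Gx; rewrite alt_squareE // !cfunE Gx groupX // !mulr1n /=.
by rewrite expgS expg1 repr_mxM // -mxtrace_alt -[X in X / _]mulr_natr mulfK
  ?pnatr_eq0.
Qed.

End AlternatingSquare.

(** * Elements of odd and of even order *)

Lemma odd_order_sqrt (gT : finGroupType) (g : gT) :
  odd #[g]%g -> ((g ^+ (#[g]%g.+1)./2) ^+ 2 = g)%g.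
Proof.
move=> odd_g; rewrite -expgM muln2 halfK /= odd_g subn0.
by rewrite expgS expg_order mulg1.
Qed.

Lemma sum_sqr_odd_order (gT : finGroupType) (G : {group gT}) (R : nmodType)
    (F : gT -> R) :
  \sum_(g in G | odd #[g]%g) F (g ^+ 2)%g = \sum_(g in G | odd #[g]%g) F g.
Proof.
rewrite [RHS](reindex_onto (fun g => g ^+ 2)%g (fun g => g ^+ (#[g]%g.+1)./2)%g).
  apply: eq_bigl => g; apply/andP/andP=> [[Gg odd_g] | [/andP[Gg odd_g2] /eqP gE]].
    have eq_ord : #[(g ^+ 2)%g]%g = #[g]%g.
      have/eqP co_g2 : coprime #[g]%g 2 by rewrite coprimen2.
      by rewrite orderXgcd co_g2 divn1.
    by rewrite groupX // eq_ord odd_g -expgM mulnC expgM odd_order_sqrt.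
  split; first by rewrite -gE groupX.
  by rewrite -gE; apply: dvdn_odd (orderXdvd _ _) odd_g2.
by move=> g /andP[_ /odd_order_sqrt].
Qed.

(** If N is the order of [g], some point is moved by g^(N/2); the length of its
    cycle divides N but not N/2, so it is even. *)
Lemma even_order_even_cycle (T : finType) (g : {perm T}) :
  ~~ odd #[g]%g -> exists x, ~~ odd (fingraph.order g x).
Proof.
move=> even_g; pose N := #[g]%g.
have NE : (N./2 * 2 = N)%N.
  by have := odd_double_half N; rewrite (negbTE even_g) muln2.
have N_gt0 : (0 < N)%N by apply: fingroup.order_gt0.
have [x gx] : exists x, (g ^+ N./2)%g x != x.
  apply/existsP; rewrite -negb_forall; apply/negP=> /forallP g_fix.
  have : (N %| N./2)%N.
    by rewrite order_dvdn; apply/eqP/permP=> x; rewrite perm1; apply/eqP.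
  move/dvdn_leq; move: (N) (N./2) NE N_gt0 => M M2; lia.
exists x; apply/negP=> odd_o.
have o_dvd : (fingraph.order g x %| N)%N.
  have gNx : iter (N %% fingraph.order g x) g x = x.
    by rewrite iter_mod_order -permX expg_order perm1.
  have := findex_iter (f := g) (x := x) (i := N %% fingraph.order g x).
  rewrite gNx findex0 ltn_mod fingraph.order_gt0 => /(_ isT) mod0.
  by rewrite /dvdn -mod0.
have : (fingraph.order g x %| N./2)%N.
  have /Gauss_dvdr<- : coprime (fingraph.order g x) 2 by rewrite coprimen2.
  by rewrite mulnC NE.
by rewrite /dvdn => /eqP mod0; case/eqP: gx; rewrite permX -iter_mod_order mod0.
Qed.

Lemma odd_perm_odd_order (T : finType) (g : {perm T}) :
  odd #[g]%g -> odd_perm g = false.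
Proof.
move=> odd_g; rewrite -[g]odd_order_sqrt //.
by rewrite expgS expg1 odd_permM addbb.
Qed.

Lemma sum_involution_eq0 (I : finType) (P : pred I) (h : I -> I) (F : I -> algC) :
    (forall i, P i -> [/\ P (h i), h (h i) = i & F (h i) = - F i]) ->
  \sum_(i | P i) F i = 0.
Proof.
move=> hP; set S := LHS.
suffices S_opp : S = - S by apply/eqP; rewrite -eqNr -S_opp.
rewrite -sumrN {1}/S (reindex_onto h h) => [|i /hP[]//].
apply: eq_big => [i | i /andP[Phi /eqP hhi]].
  by apply/andP/idP=> [[/hP[Phh _ _] /eqP<-] // | /hP[Phi -> _]].
by have [_ _] := hP _ Phi; rewrite hhi => ->; rewrite opprK.
Qed.

(** * The partition of least energy *)

(** Exchanging an element of weight at least [t] for one of weight less than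
    [t] strictly decreases the total weight. *)
Lemma light_set (I : finType) (w : I -> nat) t (S : {set I}) :
    #|S| = #|[set i | w i < t]%N| ->
    (\sum_(i in S) w i <= \sum_(i | w i < t) w i)%N ->
  S = [set i | w i < t]%N.
Proof.
set D := [set i | _]%N => eq_card le_sum.
have eq_diff : #|S :\: D| = #|D :\: S|.
  by apply/eqP; rewrite -(eqn_add2l #|S :&: D|) cardsID eq_card setIC cardsID.
have sumD : (\sum_(i | w i < t) w i = \sum_(i in D) w i)%N.
  by apply: eq_bigl => i; rewrite inE.
move: le_sum; rewrite sumD (big_setID D) [X in (_ <= X)%N](big_setID S) /=.
rewrite setIC leq_add2l => le_sum.
have geS : (t * #|S :\: D| <= \sum_(i in S :\: D) w i)%N.
  rewrite mulnC -sum_nat_const; apply: leq_sum => i.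
  by rewrite !inE -leqNgt => /andP[].
have leD : (#|D :\: S| + \sum_(i in D :\: S) w i <= t * #|D :\: S|)%N.
  rewrite mulnC -sum_nat_const -sum1_card -big_split /=; apply: leq_sum => i.
  by rewrite !inE add1n => /andP[].
have /eqP : #|S :\: D| = 0%N.
  by move: (leq_trans geS le_sum) leD; rewrite -eq_diff; lia.
rewrite cards_eq0 setD_eq0 => sSD.
by apply/eqP; rewrite eqEcard sSD eq_card leqnn.
Qed.

Section Cells.

Variables (n : nat).
Local Open Scope nat_scope.

Lemma col_lt (lam : intpart n) x : col_of lam x < n.
Proof. exact: leq_ltn_trans (leq_subr _ _) (ltn_ord x). Qed.

Definition cell (lam : intpart n) x : 'I_n * 'I_n :=
  (Ordinal (row_lt lam x), Ordinal (col_lt lam x)).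

Lemma cell_injective lam : injective (cell lam).
Proof. by move=> x y [eq_row eq_col]; apply: (@cell_inj _ lam). Qed.

Lemma cells_inj (lam mu : intpart n) :
  cell lam @: setT = cell mu @: setT -> lam = mu.
Proof.
move=> eq_cells; apply: eq_card_lt_rows => t.
have card_lt nu : #|[set x | row_of nu x < t]|
    = #|[set p in cell nu @: setT | (p.1 : 'I_n) < t]|.
  rewrite -(card_imset _ (@cell_injective nu)); apply: eq_card => p.
  apply/imsetP/setIdP=> [[x /[!inE] lt_t ->] | [/imsetP[x _ ->] lt_t]].
    by rewrite imset_f ?inE.
  by exists x; rewrite ?inE.
by rewrite !card_lt eq_cells.
Qed.

End Cells.

(** The cells of the staircase are exactly those with row + column < k. *)
Lemma staircase_of_energy k (mu : intpart (k * k.+1)./2) :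
    (\sum_x (row_of mu x + col_of mu x)
     <= \sum_x (row_of (staircase k) x + col_of (staircase k) x))%N ->
  mu = staircase k.
Proof.
move=> le_energy; pose w (p : 'I_(k * k.+1)./2 * 'I_(k * k.+1)./2) := (p.1 + p.2)%N.
have cells_stair : cell (staircase k) @: setT = [set p | w p < k]%N.
  apply/setP=> -[i j]; rewrite inE; apply/imsetP/idP=> [[x _ ->] | lt_ij].
    exact: staircase_cell.
  have [|x rx cx] := @cell_exists _ (staircase k) i j.
    by rewrite nth_staircase; move: lt_ij; rewrite /w /=; lia.
  by exists x; rewrite // /cell; congr pair; apply: val_inj.
have energyE nu : (\sum_(p in cell nu @: setT) w p
    = \sum_x (row_of nu x + col_of nu x))%N.
  rewrite big_imset /=; last by move=> x y _ _; apply: cell_injective.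
  by apply: eq_bigl => x; rewrite inE.
apply: cells_inj; rewrite cells_stair; apply: light_set.
  by rewrite -cells_stair !card_imset //; apply: cell_injective.
rewrite energyE (leq_trans le_energy) // -energyE cells_stair.
by rewrite (eq_bigl (fun p => w p < k)%N) // => p; rewrite inE.
Qed.

(** * Frobenius's combination of permutation characters *)

Section FrobeniusCombination.

Variables (n k : nat).
Local Notation G := [set: 'S_n]%G.
Local Notation coloring := {ffun 'I_n -> 'I_k}.
Implicit Types (f : coloring) (s : 'S_k) (g : 'S_n).

(** The classes of the coloring have sizes 2j+1 - s(j), which is
    (rho + delta)_j - delta_(s j) once the parts are listed increasingly. The
    subtraction is avoided so that no coloring is allowed when it would be
    negative. *)
Definition content s f :=
  [forall j, #|[set x | f x == j]| + s j == (j.*2).+1]%N.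

Definition color_stab f : {group 'S_n} := fstab_group (fun x => f x : nat).

Lemma color_stabP f g : reflect (forall x, f (g x) = f x) (g \in color_stab f).
Proof.
by apply: (iffP (fstabP _ _)) => fg x; [apply/val_inj/fg | rewrite fg].
Qed.

Definition frob_fun g : algC :=
  \sum_(p : 'S_k * coloring | content p.1 p.2)
     (-1) ^+ odd_perm p.1 * (g \in color_stab p.2)%:R.

Lemma content_comp s f g : content s [ffun x => f (g x)] = content s f.
Proof.
apply: eq_forallb => j; congr (_ + _ == _)%N.
rewrite -[RHS](on_card_preimset (onW_bij _ (injF_bij (@perm_inj _ g)))).
by apply: eq_card => x; rewrite !inE ffunE.
Qed.

Fact frob_subproof : is_class_fun <<G>>%g [ffun g => frob_fun g].
Proof.
rewrite genGid; apply: intro_class_fun => [g y _ _ | g]; last by rewrite inE.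
pose act (z : 'S_n) (p : 'S_k * coloring) := (p.1, [ffun x => p.2 (z x)]).
have actK z : cancel (act z) (act z^-1%g).
  by move=> [s f]; congr pair; apply/ffunP=> x; rewrite !ffunE /= permKV.
rewrite /frob_fun (reindex_inj (can_inj (actK y^-1%g))) /=.
apply: eq_big => [[s f] | [s f] _] /=; first exact: content_comp.
congr (_ * _%:R); congr (nat_of_bool _); apply/color_stabP/color_stabP => fg x.
  by have := fg (y x); rewrite !ffunE conjgE !permM !permK.
by rewrite !ffunE conjgE !permM permK fg.
Qed.
Definition frob_cf : 'CF(G) := Cfun 0 frob_subproof.

Lemma frobE g : frob_cf g = frob_fun g.
Proof. by rewrite cfunE. Qed.

(** Let 2m be the length of the cycle O of [x0], and j its color. Having at
    least 2m points, the color j satisfies m <= j. Exchanging the colors j and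
    j - m outside O, and composing s with the transposition of j and j - m,
    preserves the prescribed sizes and changes the sign. *)
Lemma frob_even_cycle g x0 : ~~ odd (fingraph.order g x0) -> frob_cf g = 0.
Proof.
move=> even_x0; rewrite frobE /frob_fun.
have g_sym := fconnect_sym (@perm_inj _ g).
pose m := (fingraph.order g x0)./2.
have oE : fingraph.order g x0 = m.*2.
  by rewrite -[LHS]odd_double_half (negbTE even_x0).
have m_gt0 : (0 < m)%N by rewrite -double_gt0 -oE fingraph.order_gt0.
pose O := [set y | fconnect g x0 y].
have cardO : #|O| = m.*2 by rewrite cardsE -oE.
have Ox0 : x0 \in O by rewrite inE connect0.
have Og y : (g y \in O) = (y \in O).
  by rewrite !inE -same_fconnect1_r //; apply: perm_inj.
rewrite (bigID (fun p : 'S_k * coloring => g \in color_stab p.2)) /= addrC.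
rewrite big1 ?add0r; last first.
  by move=> p /andP[_ /negbTE->]; rewrite mulr0.
(* The default value of insubd is never used, as f x0 - m < k. *)
pose t f : 'S_k := tperm (f x0) (insubd (f x0) (f x0 - m)%N).
pose h (p : 'S_k * coloring) : 'S_k * coloring :=
  ((t p.2 * p.1)%g, [ffun x => if x \in O then p.2 x else t p.2 (p.2 x)]).
apply: (sum_involution_eq0 (h := h)) => -[s f] /= /andP[cont_f f_stab].
have g_f := elimT (color_stabP f g) f_stab.
have constO y : y \in O -> f y = f x0.
  rewrite inE => /(fconnect_invariant (k := f)) -> //.
  by move=> z; rewrite /= g_f eqxx.
pose j := f x0; pose out i := #|[set x in ~: O | f x == i]|.
have card_out (f' : coloring) i : {in O, forall y, f' y = j} ->
  (#|[set x | f' x == i]| = (i == j) * m.*2 + #|[set x in ~: O | f' x == i]|)%N.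
  move=> f'O; rewrite -(cardsID O [set x | f' x == i]); congr (_ + _)%N.
    case: eqP => [->|neq_ij]; rewrite ?mul1n ?mul0n.
      rewrite -cardO; apply: eq_card => y; apply/setIP/idP=> [[]//|Oy].
      by rewrite inE f'O.
    apply: eq_card0 => y; rewrite in_setI andbC; case Oy: (y \in O) => //=.
    by rewrite inE f'O // eq_sym; apply/eqP.
  by apply: eq_card => y; rewrite !inE.
have contE i : ((i == j) * m.*2 + out i + s i = i.*2.+1)%N.
  by rewrite -card_out //; apply/eqP; move/forallP: cont_f.
have le_mj : (m <= j)%N by have := contE j; rewrite eqxx mul1n; lia.
pose j' := insubd j (j - m)%N.
have j'E : j' = (j - m)%N :> nat by rewrite val_insubd (leq_ltn_trans (leq_subr _ _)).
have neq_j : j != j' by rewrite -val_eqE /= j'E; lia.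
have tE : t f = tperm j j' by [].
have hx0 : (h (s, f)).2 x0 = f x0 by rewrite ffunE Ox0.
have th : t (h (s, f)).2 = t f by rewrite /t hx0.
have h_stab : g \in color_stab (h (s, f)).2.
  by apply/color_stabP=> x; rewrite !ffunE Og g_f.
split.
- rewrite h_stab andbT; apply/forallP=> i; apply/eqP.
  rewrite card_out => [|y Oy]; last by rewrite ffunE Oy constO.
  have -> : #|[set x in ~: O | (h (s, f)).2 x == i]| = out (t f i).
    apply: eq_card => x; rewrite !inE ffunE inE.
    case: (fconnect g x0 x) => //=.
    rewrite -[RHS](inj_eq (@perm_inj _ (t f))) tE.
    by rewrite (tpermK j j' i).
  rewrite permM tE; have := contE j; have := contE j'; have := contE i.
  rewrite eqxx (eq_sym j' j) (negbTE neq_j) mul1n mul0n.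
  case: tpermP => [->|->|/eqP/negbTE-> /eqP/negbTE _];
    rewrite ?eqxx ?(eq_sym j' j) ?(negbTE neq_j) /=; lia.
- rewrite {1}/h th; congr pair.
    by rewrite mulgA tperm2 mul1g.
  apply/ffunP=> x; rewrite !ffunE; case: (x \in O) => //.
  by rewrite tE (tpermK j j').
by rewrite h_stab f_stab tE odd_mul_tperm neq_j signr_addb mulN1r mulNr.
Qed.

Lemma frob_even_order g : ~~ odd #[g]%g -> frob_cf g = 0.
Proof. by case/even_order_even_cycle=> x; apply: frob_even_cycle. Qed.

Lemma frob_sqr g : odd #[g]%g -> frob_cf (g ^+ 2)%g = frob_cf g.
Proof.
move=> odd_g; rewrite !frobE; apply: eq_bigr => p _; congr (_ * _%:R).
congr (nat_of_bool _); apply/idP/idP => [stab_g2 | /groupX]; last exact.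
by rewrite -[g]odd_order_sqrt // expgAC groupX.
Qed.

(** The support consists of elements of odd order, which are even
    permutations. *)
Lemma frob_sign g : (-1) ^+ odd_perm g * frob_cf g = frob_cf g.
Proof.
have [/odd_perm_odd_order-> | /frob_even_order->] := boolP (odd #[g]%g).
  by rewrite mul1r.
by rewrite mulr0.
Qed.

Lemma exists_of_sum_neq0 (I : finType) (P : pred I) (F : I -> algC) :
  \sum_(i | P i) F i != 0 -> exists2 i, P i & F i != 0.
Proof.
move=> nz; apply/exists_inP; apply: contraR nz => /exists_inPn all0.
by apply/eqP/big1 => i Pi; apply/eqP; have /negPn := all0 i Pi.
Qed.

Lemma sum_frob (c : 'S_n -> algC) (A : {pred 'S_n}) :
  \sum_(g in A) frob_cf g * c g = \sum_(p : 'S_k * coloring | content p.1 p.2)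
    (-1) ^+ odd_perm p.1 * \sum_(g in A) (g \in color_stab p.2)%:R * c g.
Proof.
under eq_bigr do rewrite frobE /frob_fun big_distrl /=.
rewrite exchange_big; apply: eq_bigr => p _; rewrite big_distrr /=.
by apply: eq_bigr => g _; rewrite mulrA.
Qed.

Section Constituent.

Variable mu : intpart n.

(** If two points of a column have the same color, their transposition fixes
    the coloring and the sum over the column stabilizer cancels. *)
Lemma stab_young_col f :
    \sum_g (g \in color_stab f)%:R * young_coef mu g != 0 ->
  injective (fun x => (f x : nat, col_of mu x)).
Proof.
move=> nz; apply/injectiveP; apply: contraR nz.
case/injectivePn=> i [j neq_ij [fij cij]].
apply/eqP; transitivity (\sum_(p in row_stab mu) \sum_(q in col_stab mu)
    (-1) ^+ odd_perm q * ((q * p)%g \in color_stab f)%:R : algC).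
  rewrite /young_coef; under eq_bigr do rewrite big_distrr.
  rewrite exchange_big; apply: eq_bigr => p _ /=.
  under eq_bigr do rewrite big_distrr.
  rewrite exchange_big; apply: eq_bigr => q _ /=.
  rewrite (bigD1 (q * p)%g) //= eqxx mulr1 mulrC big1 ?addr0 // => x /negbTE->.
  by rewrite !mulr0.
apply: big1 => p _; apply: (sum_sign_eq0 neq_ij cij) => q.
by rewrite -mulgA groupMl // tperm_fstab.
Qed.

(** Multiplying by the sign character exchanges the roles of the two
    stabilizers. *)
Lemma sign_stab_young_row f :
    \sum_g (g \in color_stab f)%:R * ((-1) ^+ odd_perm g * young_coef mu g) != 0 ->
  injective (fun x => (f x : nat, row_of mu x)).
Proof.
move=> nz; apply/injectiveP; apply: contraR nz.
case/injectivePn=> i [j neq_ij [fij cij]].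
apply/eqP; transitivity (\sum_(q in col_stab mu) \sum_(p in row_stab mu)
    (-1) ^+ odd_perm p * ((q * p)%g \in color_stab f)%:R : algC).
  rewrite /young_coef; under eq_bigr do rewrite 2!big_distrr.
  rewrite exchange_big /= [RHS]exchange_big; apply: eq_bigr => p _ /=.
  under eq_bigr do rewrite 2!big_distrr.
  rewrite exchange_big; apply: eq_bigr => q _ /=.
  rewrite (bigD1 (q * p)%g) //= eqxx mulr1 big1 ?addr0 => [|x /negbTE->].
    by rewrite odd_permM signr_addb mulrAC -expr2 sqrr_sign mul1r mulrC.
  by rewrite !mulr0.
apply: big1 => q _; rewrite (reindex_inj invg_inj) /=.
pose F (p : 'S_n) : algC := ((q * p^-1)%g \in color_stab f)%:R.
rewrite -[RHS](sum_sign_eq0 (r := row_of mu) (F := F) neq_ij cij).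
  apply: eq_big => p; first exact: (groupV (fstab_group (row_of mu))).
  by rewrite odd_permV.
by move=> p; rewrite /F invMg tpermV mulgA groupMr // tperm_fstab.
Qed.

(** The second half uses that the function is invariant under multiplication by
    the sign character. *)
Lemma frob_constituent :
    '[frob_cf, sym_char mu] != 0 ->
  (exists s f, content s f /\ injective (fun x => (f x : nat, col_of mu x)))
  /\ (exists s f, content s f /\ injective (fun x => (f x : nat, row_of mu x))).
Proof.
rewrite cfdot_sym_char mulf_eq0 negb_or => /andP[_ nz].
have nz' : \sum_g frob_cf g * ((-1) ^+ odd_perm g * young_coef mu g) != 0.
  rewrite (eq_bigr (fun g => frob_cf g * young_coef mu g)) // => g _.
  by rewrite mulrA [frob_cf g * _]mulrC frob_sign.
move: nz nz'; rewrite !(sum_frob _ predT) => /exists_of_sum_neq0[[s f] cont_f nz].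
case/exists_of_sum_neq0=> -[s' f'] cont_f' nz'; split.
  exists s, f; split=> //; apply: stab_young_col.
  by move: nz; rewrite mulf_eq0 negb_or => /andP[].
exists s', f'; split=> //; apply: sign_stab_young_row.
by move: nz'; rewrite mulf_eq0 negb_or => /andP[].
Qed.

End Constituent.

End FrobeniusCombination.

(** * The staircase character *)

(** Sum 2 j s(j) <= j^2 + s(j)^2 over j. *)
Lemma perm_rearrangement k (s : 'S_k) :
  (\sum_(j < k) j * s j <= \sum_(j < k) j * j)%N
    /\ ((\sum_(j < k) j * s j)%N = (\sum_(j < k) j * j)%N -> s = 1%g).
Proof.
have sum_sqr : (\sum_(j < k) (s j) ^ 2 = \sum_(j < k) j * j)%N.
  by rewrite [RHS](reindex_inj (@perm_inj _ s)); apply: eq_bigr => j _; rewrite mulnn.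
have /leqif_sum amgm : forall j : 'I_k, true ->
    (2 * (j * s j) <= j ^ 2 + (s j) ^ 2 ?= iff (j == s j :> nat))%N.
  by move=> j _; apply: nat_Cauchy.
move: amgm; rewrite -big_distrr big_split /= sum_sqr.
under [X in (_ <= X + _ ?= iff _)%N]eq_bigr do rewrite -mulnn.
rewrite addnn -mul2n => -[le_sum eq_sum];
split; first by rewrite leq_pmul2l in le_sum.
move=> sum_eq; move: eq_sum; rewrite sum_eq eqxx => /esym/forall_inP s_id.
by apply/permP=> j; rewrite perm1; apply: val_inj; apply/esym/eqP/s_id.
Qed.

Section ContentEnergy.
Local Open Scope nat_scope.

Variables n k : nat.
Implicit Types (f : {ffun 'I_n -> 'I_k}) (s : 'S_k).

Lemma sum_content s f : content s f ->
  \sum_x f x + \sum_(j < k) j * s j = \sum_(j < k) j * j.*2.+1.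
Proof.
move=> /forallP cont_f.
rewrite (partition_big f xpredT) //= -big_split; apply: eq_bigr => j _ /=.
rewrite -(eqP (cont_f j)) mulnDr; congr (_ + _).
rewrite (eq_bigr (fun=> j * 1)) => [|x /eqP->]; last by rewrite muln1.
by rewrite -big_distrr /= sum1dep_card.
Qed.

Lemma sum_rev_color f :
  \sum_x (k.-1 - f x) + \sum_x f x = n * k.-1.
Proof.
rewrite -big_split /= -[X in X * _]card_ord -sum_nat_const.
by apply: eq_bigr => x _; rewrite subnK //; have := ltn_ord (f x); lia.
Qed.

(* optimal content *)
(** The reversed coloring k-1 - f is injective on the columns, so its sum is at
    least the sum of the row indices, while the sum of the colors is determined
    by the content. *)
Lemma content_bound s f (r c : 'I_n -> nat) :
    (forall x i, i <= r x -> exists2 y, r y = i & c y = c x) ->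
    content s f -> injective (fun x => (f x : nat, c x)) ->
  \sum_x r x + \sum_(j < k) j * j.*2.+1 <= n * k.-1 + \sum_(j < k) j * s j.
Proof.
move=> r_down cont_f inj_f.
have rev_inj : injective (fun x => (k.-1 - f x, c x)).
  move=> x y [eq_f eq_c]; apply: inj_f; rewrite eq_c; congr pair.
  by have := ltn_ord (f x); have := ltn_ord (f y); lia.
have := sum_dominated r_down rev_inj.
by rewrite -(sum_content cont_f) -(sum_rev_color f); lia.
Qed.

Lemma content_attained f (r : 'I_n -> nat) :
    (forall x, f x + r x = k.-1) -> content 1%g f ->
  \sum_x r x + \sum_(j < k) j * j.*2.+1 = n * k.-1 + \sum_(j < k) j * j.
Proof.
move=> fr cont_f; rewrite -(sum_content cont_f) -(sum_rev_color f).
have -> : \sum_x (k.-1 - f x) = \sum_x r x.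
  by apply: eq_bigr => x _; rewrite -(fr x) addKn.
by rewrite addnA; congr (_ + _); apply: eq_bigr => j _; rewrite perm1.
Qed.

End ContentEnergy.

Section StaircaseCharacter.

Variable k : nat.
Let n := (k * k.+1)./2.
Local Notation rho := (staircase k).
Local Notation Phi := (frob_cf n k).

Lemma staircase_coloring (r : 'I_n -> nat) :
    (forall x, r x < k)%N -> (forall i, #|[set x | r x == i]| = k - i)%N ->
  exists f : {ffun 'I_n -> 'I_k}, (forall x, f x + r x = k.-1)%N /\ content 1%g f.
Proof.
move=> r_lt r_card.
have rev_lt x : (k.-1 - r x < k)%N by have := r_lt x; lia.
pose f := [ffun x => Ordinal (rev_lt x)]; exists f.
have fr x : (f x + r x = k.-1)%N by rewrite ffunE /=; have := r_lt x; lia.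
split=> //; clearbody f; apply/forallP=> j; rewrite perm1.
have -> : #|[set x | f x == j]| = #|[set x | r x == k.-1 - j]|%N.
  apply: eq_card => x; rewrite !inE; have := fr x; have := ltn_ord j.
  move=> lt_j fx; apply/eqP/eqP=> [fj | rj].
    by rewrite -fj -fx addKn.
  by apply: ord_inj; lia.
by rewrite r_card; have := ltn_ord j; lia.
Qed.

Lemma row_coloring : exists f : {ffun 'I_n -> 'I_k},
  (forall x, f x + row_of rho x = k.-1)%N /\ content 1%g f.
Proof.
apply: staircase_coloring; last exact: card_row_staircase.
by move=> x; apply: leq_ltn_trans (staircase_cell x); apply: leq_addr.
Qed.

Lemma col_coloring : exists f : {ffun 'I_n -> 'I_k},
  (forall x, f x + col_of rho x = k.-1)%N /\ content 1%g f.
Proof.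
apply: staircase_coloring; last exact: card_col_staircase.
by move=> x; apply: leq_ltn_trans (staircase_cell x); apply: leq_addl.
Qed.

(** Both the rows and the columns of mu have an index sum at most that of the
    staircase, by the rearrangement inequality. *)
Lemma frob_constituent_eq (mu : intpart n) : '[Phi, sym_char mu] != 0 -> mu = rho.
Proof.
case/frob_constituent=> -[s [f [cont_f f_inj]]] [s' [f' [cont_f' f'_inj]]].
have rows := content_bound (@row_down n mu) cont_f f_inj.
have cols := content_bound (@col_down n mu) cont_f' f'_inj.
have [fr [fr_sum fr_cont]] := row_coloring.
have [fc [fc_sum fc_cont]] := col_coloring.
have [le_s _] := perm_rearrangement s; have [le_s' _] := perm_rearrangement s'.
pose E := (\sum_(j < k) j * j.*2.+1)%N.
apply: staircase_of_energy; rewrite !big_split /=.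
apply: leq_add; rewrite -(leq_add2r E).
  by rewrite (content_attained fr_sum fr_cont) (leq_trans rows) ?leq_add2l.
by rewrite (content_attained fc_sum fc_cont) (leq_trans cols) ?leq_add2l.
Qed.

(** Pair the function with the sign character of the column stabilizer of the
    staircase. A coloring that is not injective on columns contributes 0, and
    the others have trivial stabilizer; the energy bound forces s = 1 for them,
    so all the contributions are positive, and the reversed row index provides
    one. *)
Lemma frob_neq0 : exists g, Phi g != 0.
Proof.
pose C := col_stab rho.
suffices nz : \sum_(q in C) Phi q * (-1) ^+ odd_perm q != 0.
  have [q _ nzq] := exists_of_sum_neq0 nz; exists q.
  by move: nzq; rewrite mulf_eq0 negb_or => /andP[].
rewrite sum_frob.
pose inj_col (f : {ffun 'I_n -> 'I_k}) :=
  injectiveb (fun x => (f x : nat, col_of rho x)).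
have stabC f : \sum_(q in C) (q \in color_stab f)%:R * (-1) ^+ odd_perm q
    = (inj_col f)%:R :> algC.
  have [/injectiveP f_inj | not_inj] := boolP (inj_col f).
    rewrite (bigD1 1%g) /= ?(group1 (fstab_group (col_of rho))) //.
    rewrite group1 odd_perm1 mulr1 big1 ?addr0 // => q /andP[Cq q_neq1].
    case: (boolP (q \in _)) => [/color_stabP fq | _]; last by rewrite mul0r.
    case/eqP: q_neq1; apply/permP=> x; rewrite perm1; apply: f_inj.
    by rewrite fq (elimT (@fstabP _ (col_of rho) q) Cq).
  have /injectivePn[i [j neq_ij [fij cij]]] := not_inj.
  pose F (q : 'S_n) : algC := (q \in color_stab f)%:R.
  rewrite -[RHS](sum_sign_eq0 (r := col_of rho) (F := F) neq_ij cij).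
    by apply: eq_bigr => q _; rewrite mulrC.
  by move=> q; rewrite /F groupMl // tperm_fstab.
under eq_bigr do rewrite stabC.
have [f0 [f0_sum f0_cont]] := row_coloring.
rewrite (eq_bigr (fun p => (inj_col p.2)%:R)) => [|[s f] /= cont_f]; last first.
  case: (boolP (inj_col f)) => [/injectiveP f_inj | _]; last by rewrite mulr0.
  have := content_bound (@row_down n rho) cont_f f_inj.
  rewrite (content_attained f0_sum f0_cont) leq_add2l => ge_s.
  have [le_s eq_s] := perm_rearrangement s.
  by rewrite eq_s ?odd_perm1 ?mulr1 //; apply/eqP; rewrite eqn_leq le_s ge_s.
rewrite -natr_sum pnatr_eq0 -lt0n (bigD1 (1%g, f0)) //=.
suffices -> : inj_col f0 by [].
apply/injectiveP=> x y [eq_f eq_c]; apply: (@cell_inj _ rho) => //.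
by apply/eqP; rewrite -(eqn_add2l (f0 x)) {2}eq_f !f0_sum.
Qed.

Lemma staircase_char_frob : exists a : algC, forall g, sym_char rho g = a * Phi g.
Proof.
have /irrP[i0 rhoE] := sym_char_irr rho.
have phiZ : Phi = '[Phi, sym_char rho] *: sym_char rho.
  rewrite {1}[Phi]cfun_sum_cfdot (bigD1 i0) //= -rhoE big1 ?addr0 // => i neq_i.
  have [-> | nz] := eqVneq '[Phi, 'chi_i] 0; first by rewrite scale0r.
  have [mu chiE] := irr_is_sym_char i.
  case/eqP: neq_i; apply: irr_inj; rewrite -rhoE chiE; congr sym_char.
  by apply: frob_constituent_eq; rewrite -chiE.
have frob_g g : Phi g = '[Phi, sym_char rho] * sym_char rho g.
  by rewrite {1}phiZ cfunE.
exists '[Phi, sym_char rho]^-1 => g.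
have [g0 nz_g0] := frob_neq0; rewrite frob_g mulKf //.
by apply: contraNneq nz_g0 => dot0; rewrite frob_g dot0 mul0r.
Qed.

Lemma staircase_even_order g : ~~ odd #[g]%g -> sym_char rho g = 0.
Proof.
by have [a ->] := staircase_char_frob => /frob_even_order->; rewrite mulr0.
Qed.

Lemma staircase_sqr g : odd #[g]%g -> sym_char rho (g ^+ 2)%g = sym_char rho g.
Proof. by have [a aE] := staircase_char_frob => odd_g; rewrite !aE frob_sqr. Qed.

(** The left-hand side is the scalar product of [rho] with g |-> chi(g^2). *)
Lemma cfdot_adams2 (chi : 'CF([set: 'S_n])) :
  '[sym_square chi, sym_char rho] - '[alt_square chi, sym_char rho]
    = '[chi, sym_char rho].
Proof.
pose G := [set: 'S_n]%G.
rewrite -cfdotBl !cfdotE; congr (_ * _).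
have odd_only (F : 'S_n -> algC) :
    \sum_(g in G) F g * (sym_char rho g)^*
      = \sum_(g in G | odd #[g]%g) F g * (sym_char rho g)^*.
  rewrite (bigID (fun g : 'S_n => odd #[g]%g)) /= addrC big1 ?add0r // => g.
  by case/andP=> _ /staircase_even_order->; rewrite conjC0 mulr0.
rewrite !odd_only -[RHS]sum_sqr_odd_order; apply: eq_bigr => g /andP[Gg odd_g].
rewrite staircase_sqr // !cfunE Gg mul1r mulN1r; congr (_ * _).
rewrite -mulrBl opprB addrC addrA subrK -mulr2n.
by rewrite -[_ *+ 2]mulr_natr mulfK ?pnatr_eq0.
Qed.

End StaircaseCharacter.

Theorem theoremD (k : nat) (hk : (1 <= k)%N)
    (lam : intpart (k * k.+1)./2) (hlam : lam <> staircase k) :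
  '[sym_square (sym_char lam), sym_char (staircase k)]
    = '[alt_square (sym_char lam), sym_char (staircase k)]
  /\ (exists m : nat, kronecker lam lam (staircase k) = (m.*2)%:R).
Proof.
have eq_dot : '[sym_square (sym_char lam), sym_char (staircase k)]
    = '[alt_square (sym_char lam), sym_char (staircase k)].
  apply/eqP; rewrite -subr_eq0 cfdot_adams2 cfdot_sym_charE.
  by rewrite (introF eqP hlam).
split=> //.
have char_lam := sym_char_char lam; have char_rho := sym_char_char (staircase k).
have /natrP[m mE] := Cnat_cfdot_char (alt_square_char char_lam) char_rho.
exists m; rewrite kroneckerE.
have -> : sym_char lam * sym_char lam
    = sym_square (sym_char lam) + alt_square (sym_char lam).
  apply/cfun_inP=> g Gg; rewrite !cfunE Gg mul1r mulN1r -mulrDl addrACA subrr.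
  by rewrite addr0 -mulr2n -[_ *+ 2]mulr_natr mulfK ?pnatr_eq0 // expr2.
by rewrite cfdotDl eq_dot mE -natrD addnn.
Qed.
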